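(* Let $C$ be a coalgebra over a field $k$, with coradical filtration $C_0\subseteq C_1\subseteq\cdots$, such that $C=C_n$ for some $n\geq 0$. Then the rational part of the right (or left) $C^*$-module $C^*$ is non-zero.
   Context: $k$ is a field; $C^*=\operatorname{Hom}_k(C,k)$ is the dual algebra of $C$ with the convolution product, regarded as a right (or left) module over itself by multiplication. The coradical $C_0$ is the sum of all simple subcoalgebras of $C$, and the coradical filtration is defined inductively by $C_{n+1}=\Delta^{-1}(C_n\otimes C+C\otimes C_0)$, where $\Delta$ is the comultiplication of $C$. The rational part of the right $C^*$-module $C^*$ is its largest rational submodule, i.e. the set of $f\in C^*$ for which there exist finitely many $f_i\in C^*$, $c_i\in C$ with $fg=\sum_i g(c_i)f_i$ for all $g\in C^*$. The rational part of the left $C^*$-module $C^*$ is defined in the same way with $gf$ in place of $fg$. *)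

(* Defs.v *)
From HB Require Import structures.
From mathcomp Require Import all_boot all_algebra generic_quotient.
From mathcomp Require Import ring_quotient sesquilinear freeg.
From mathcomp Require Import boolp classical_sets.

Set Implicit Arguments.
Unset Strict Implicit.
Unset Printing Implicit Defensive.

Import GRing.Theory.

Local Open Scope classical_set_scope.
Local Open Scope ring_scope.
Local Open Scope quotient_scope.

Section Span.
Context {k : fieldType} {M : lmodType k}.
Implicit Types A B : set M.

Definition subspace A : Prop :=
  A 0 /\ forall (a : k) x y, A x -> A y -> A (a *: x + y).

Definition span A : set M :=
  [set x | exists2 s : seq (k * M), (forall p, p \in s -> A p.2)
                                  & x = \sum_(p <- s) p.1 *: p.2].

Lemma subspace_span A : subspace (span A).
Proof.
split; first by exists [::] => //; rewrite big_nil.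
move=> a x y [s sA ->] [t tA ->].
exists ([seq (a * p.1, p.2) | p <- s] ++ t).
  by move=> p; rewrite mem_cat => /orP[/mapP[q /sA ? ->] //|/tA].
rewrite big_cat big_map scaler_sumr; congr (_ + _).
by apply: eq_bigr => p _; rewrite scalerA.
Qed.

Lemma sub_span A : A `<=` span A.
Proof.
move=> x Ax; exists [:: (1, x)]; last by rewrite big_seq1 scale1r.
by move=> p; rewrite inE => /eqP->.
Qed.

Lemma span_min A B : subspace B -> A `<=` B -> span A `<=` B.
Proof.
move=> [B0 BD] AB _ [s sA ->]; elim: s sA => [|p s IHs] sA.
  by rewrite big_nil.
rewrite big_cons; apply: BD; first by apply/AB/sA; rewrite inE eqxx.
by apply: IHs => q qs; apply: sA; rewrite inE qs orbT.
Qed.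

End Span.

(* The tensor product of vector spaces: the free vector space on U * V modulo *)
(* the subspace spanned by the bilinearity relations.                         *)
Section Tensor.
Context {k : fieldType} (U V : lmodType k).

Let F : lmodType k := {freeg (U * V)%type / k}.
Let d (u : U) (v : V) : F := << (u, v) >>.

Definition tensor_rel : set F :=
  [set x | (exists a u1 u2 v, x = d (a *: u1 + u2) v - (a *: d u1 v + d u2 v))
        \/ (exists a u v1 v2, x = d u (a *: v1 + v2) - (a *: d u v1 + d u v2))].

Definition tensor_null : {pred F} := fun x => `[< span tensor_rel x >].

Fact tensor_null_zmod_closed : zmod_closed tensor_null.
Proof.
have [S0 SD] := subspace_span tensor_rel.
split; first exact/asboolP.
move=> x y /asboolP Sx /asboolP Sy; apply/asboolP.
by rewrite addrC -scaleN1r; apply: SD.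
Qed.

HB.instance Definition _ :=
  GRing.isZmodClosed.Build F tensor_null tensor_null_zmod_closed.

Definition tensor : Type := ring_quotient.Quotient.quot tensor_null.

HB.instance Definition _ := Choice.on tensor.
HB.instance Definition _ := GRing.Zmodule.on tensor.

Let pr (x : F) : tensor := \pi_(ring_quotient.Quotient.quot tensor_null) x.

Lemma tensor_prP x y : span tensor_rel (x - y) <-> pr x = pr y.
Proof.
split=> [xy|/eqP]; first by apply/eqP; rewrite -ring_quotient.Quotient.idealrBE; apply/asboolP.
by rewrite -ring_quotient.Quotient.idealrBE => /asboolP.
Qed.

Lemma tensor_prK (t : tensor) : pr (repr t) = t.
Proof. exact: reprK. Qed.

Lemma tensor_prD x y : pr (x + y) = pr x + pr y.
Proof. by rewrite /pr raddfD. Qed.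

Definition tensor_scale (a : k) (t : tensor) : tensor := pr (a *: repr t).

Lemma tensor_prZ a x : pr (a *: x) = tensor_scale a (pr x).
Proof.
apply/tensor_prP; rewrite -scalerBr -[_ *: _]addr0.
have [S0 SD] := subspace_span tensor_rel; apply: SD => //.
by apply/tensor_prP; rewrite tensor_prK.
Qed.

Fact tensor_scaleA a b t :
  tensor_scale a (tensor_scale b t) = tensor_scale (a * b) t.
Proof. by rewrite -(tensor_prK t) -!tensor_prZ scalerA. Qed.

Fact tensor_scale1 : left_id 1 tensor_scale.
Proof. by move=> t; rewrite -(tensor_prK t) -!tensor_prZ scale1r. Qed.

Fact tensor_scaleDr : right_distributive tensor_scale +%R.
Proof.
move=> a s t; rewrite -(tensor_prK s) -(tensor_prK t).
by rewrite -tensor_prD -!tensor_prZ scalerDr tensor_prD.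
Qed.

Fact tensor_scaleDl t : {morph tensor_scale^~ t : a b / a + b}.
Proof.
by move=> a b; rewrite -(tensor_prK t) -!tensor_prZ scalerDl tensor_prD.
Qed.

HB.instance Definition _ := GRing.Zmodule_isLmodule.Build k tensor
  tensor_scaleA tensor_scale1 tensor_scaleDr tensor_scaleDl.

Let prZ a x : pr (a *: x) = a *: pr x.
Proof. exact: tensor_prZ. Qed.

Definition tens (u : U) (v : V) : tensor := pr (d u v).

Fact tens_bilinear : bilinear_for *:%R *:%R tens.
Proof.
split=> [v|u] a x y /=; rewrite /tens.
  rewrite -prZ -tensor_prD; apply/tensor_prP/sub_span.
  by left; exists a, x, y, v.
rewrite -prZ -tensor_prD; apply/tensor_prP/sub_span.
by right; exists a, u, x, y.
Qed.

HB.instance Definition _ :=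
  bilinear_isBilinear.Build k U V tensor *:%R *:%R tens tens_bilinear.

Lemma tensor_sum (t : tensor) :
  exists s : seq (U * V), t = \sum_(p <- s) tens p.1 p.2.
Proof.
exists [seq (coeff p (repr t) *: p.1, p.2) | p <- dom (repr t)].
rewrite big_map -{1}(tensor_prK t) -{1}(freeg_sumE (repr t)).
rewrite (big_morph pr tensor_prD (id1 := 0)); last exact: raddf0.
apply: eq_bigr => -[u v] _; rewrite linearZl_LR /= /tens -prZ /d.
congr pr; apply/eqP/freeg_eqP => x.
by rewrite coeffZ !coeffU mul1r.
Qed.

Section Lift.
Context {W : lmodType k} (B : {bilinear U -> V -> W}).

Definition tensor_lift (t : tensor) : W :=
  fglift (fun p : U * V => B p.1 p.2) (repr t).

Let L : F -> W := fglift (fun p : U * V => B p.1 p.2).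

Let LB x y : L (x - y) = L x - L y.
Proof. exact: lift_is_additive. Qed.

Let L0 : L 0 = 0.
Proof. by rewrite -(subrr 0) LB subrr. Qed.

Let LD x y : L (x + y) = L x + L y.
Proof. by rewrite -[y in LHS]opprK -[- y]sub0r !LB L0 sub0r opprK. Qed.

Let LZ a x : L (a *: x) = a *: L x.
Proof.
rewrite -(freeg_sumE x) scaler_sumr !(big_morph L LD L0) scaler_sumr.
apply: eq_bigr => p _.
have -> : a *: << coeff p x *g p >> = << a * coeff p x *g p >> :> F.
  by apply/eqP/freeg_eqP => y; rewrite coeffZ !coeffU mulrA.
by rewrite /L !liftU scalerA.
Qed.

Let Ld u v : L (d u v) = B u v.
Proof. by rewrite /L liftU scale1r. Qed.

Let L_null x : span tensor_rel x -> L x = 0.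
Proof.
move=> Sx; apply: (span_min (B := [set x | L x = 0]) _ _ Sx) => [|y [|]].
- by split=> [|a y z /= Ly Lz] //=; rewrite LD LZ Ly Lz scaler0 addr0.
- by case=> a [u1 [u2 [v ->]]] /=; rewrite LB LD LZ !Ld linearPl subrr.
- by case=> a [u [v1 [v2 ->]]] /=; rewrite LB LD LZ !Ld linearPr subrr.
Qed.

Let lift_pr x : tensor_lift (pr x) = L x.
Proof.
by apply/eqP; rewrite -subr_eq0 -LB; apply/eqP/L_null/tensor_prP/tensor_prK.
Qed.

Fact tensor_lift_linear : linear tensor_lift.
Proof.
move=> a s t; rewrite -(tensor_prK s) -(tensor_prK t).
by rewrite -prZ -tensor_prD !lift_pr LD LZ.
Qed.

HB.instance Definition _ :=
  GRing.isLinear.Build k tensor W *:%R tensor_lift tensor_lift_linear.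

Lemma tensor_liftE u v : tensor_lift (tens u v) = B u v.
Proof. by rewrite /tens lift_pr Ld. Qed.

Lemma tensor_lift_unique (f : {linear tensor -> W}) :
  (forall u v, f (tens u v) = B u v) -> f =1 tensor_lift.
Proof.
move=> fB t; have [s ->] := tensor_sum t; rewrite !linear_sum.
by apply: eq_bigr => p _; rewrite fB /= tensor_liftE.
Qed.

End Lift.
End Tensor.

Arguments tensor_lift {k U V W} B t.
Notation "u \ot v" := (tens u v) (at level 40, left associativity) : ring_scope.

Section TensorMaps.
Context {k : fieldType}.

Section Map.
Context {U V U' V' : lmodType k} (f : {linear U -> U'}) (g : {linear V -> V'}).

Definition tensor_map_fun u v := f u \ot g v.

Fact tensor_map_bilinear : bilinear_for *:%R *:%R tensor_map_fun.
Proof.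
by split=> [v|u] a x y /=; rewrite /tensor_map_fun linearP ?linearPl ?linearPr.
Qed.

HB.instance Definition _ := bilinear_isBilinear.Build k U V (tensor U' V')
  *:%R *:%R tensor_map_fun tensor_map_bilinear.

Definition tensor_map : {linear tensor U V -> tensor U' V'} :=
  tensor_lift tensor_map_fun.

Lemma tensor_mapE u v : tensor_map (u \ot v) = f u \ot g v.
Proof. exact: tensor_liftE. Qed.

End Map.

Section Assoc.
Context {U V W : lmodType k}.

Definition tensor_assoc_in (w : W) (u : U) (v : V) : tensor U (tensor V W) := u \ot (v \ot w).

Fact tensor_assoc_in_bilinear w : bilinear_for *:%R *:%R (tensor_assoc_in w).
Proof.
by split=> [v|u] a x y /=; rewrite /tensor_assoc_in ?linearPl ?linearPr.
Qed.

HB.instance Definition _ w := bilinear_isBilinear.Build k U V _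
  *:%R *:%R (tensor_assoc_in w) (tensor_assoc_in_bilinear w).

Definition tensor_assoc_out (t : tensor U V) (w : W) := tensor_lift (tensor_assoc_in w) t.

Fact tensor_assoc_out_bilinear : bilinear_for *:%R *:%R tensor_assoc_out.
Proof.
split=> [w|t] a x y /=; rewrite /tensor_assoc_out; first exact: linearP.
have [s ->] := tensor_sum t; rewrite !linear_sum -big_split.
apply: eq_bigr => p _ /=.
by rewrite !tensor_liftE /= /tensor_assoc_in !linearPr.
Qed.

HB.instance Definition _ := bilinear_isBilinear.Build k (tensor U V) W _
  *:%R *:%R tensor_assoc_out tensor_assoc_out_bilinear.

Definition tensor_assoc :
    {linear tensor (tensor U V) W -> tensor U (tensor V W)} :=
  tensor_lift tensor_assoc_out.

Lemma tensor_assocE u v w : tensor_assoc (u \ot v \ot w) = u \ot (v \ot w).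
Proof. by rewrite /tensor_assoc /= tensor_liftE /= /tensor_assoc_out tensor_liftE. Qed.

End Assoc.

Section Scale.
Context {V : lmodType k}.

Definition tensor_lscale (a : k^o) (v : V) : V := a *: v.
Definition tensor_rscale (v : V) (a : k^o) : V := a *: v.

Fact tensor_lscale_bilinear : bilinear_for *:%R *:%R tensor_lscale.
Proof.
split=> [v|b] a x y /=; rewrite /tensor_lscale; first by rewrite scalerDl scalerA.
by rewrite scalerDr !scalerA mulrC.
Qed.

Fact tensor_rscale_bilinear : bilinear_for *:%R *:%R tensor_rscale.
Proof.
split=> [b|v] a x y /=; rewrite /tensor_rscale; last by rewrite scalerDl scalerA.
by rewrite scalerDr !scalerA mulrC.
Qed.

HB.instance Definition _ := bilinear_isBilinear.Build k k^o V V
  *:%R *:%R tensor_lscale tensor_lscale_bilinear.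
HB.instance Definition _ := bilinear_isBilinear.Build k V k^o V
  *:%R *:%R tensor_rscale tensor_rscale_bilinear.

Definition tensor_unitl : {linear tensor k^o V -> V} := tensor_lift tensor_lscale.
Definition tensor_unitr : {linear tensor V k^o -> V} := tensor_lift tensor_rscale.

Lemma tensor_unitlE a v : tensor_unitl (a \ot v) = a *: v.
Proof. exact: tensor_liftE. Qed.

Lemma tensor_unitrE v a : tensor_unitr (v \ot a) = a *: v.
Proof. exact: tensor_liftE. Qed.

End Scale.
End TensorMaps.

HB.mixin Record Lmodule_isCoalgebra (k : fieldType) C of GRing.Lmodule k C := {
  comul : {linear C -> tensor C C};
  counit : {linear C -> k^o};
  comulA : forall x : C,
    tensor_assoc (tensor_map comul idfun (comul x))
    = tensor_map idfun comul (comul x);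
  counitl : forall x : C, tensor_unitl (tensor_map counit idfun (comul x)) = x;
  counitr : forall x : C, tensor_unitr (tensor_map idfun counit (comul x)) = x
}.

#[short(type="coalgType")]
HB.structure Definition Coalgebra (k : fieldType) :=
  {C of GRing.Lmodule k C & Lmodule_isCoalgebra k C}.

(* The image of A (x) B in V (x) V. *)
Definition tensor_set {k : fieldType} {V : lmodType k} (A B : set V) :
  set (tensor V V) := span [set a \ot b | a in A & b in B].

Section CoradicalFiltration.
Context {k : fieldType} (C : coalgType k).

Definition subcoalgebra (D : set C) : Prop :=
  subspace D /\ forall x, D x -> tensor_set D D (comul x).

Definition simple_subcoalgebra (D : set C) : Prop :=
  [/\ subcoalgebra D, D <> [set 0]
    & forall E, subcoalgebra E -> E `<=` D -> E = [set 0] \/ E = D].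

Definition coradical : set C :=
  span (\bigcup_(D in simple_subcoalgebra) D).

Fixpoint coradical_filtration (n : nat) : set C :=
  if n is m.+1 then
    comul @^-1` [set s + t | s in tensor_set (coradical_filtration m) setT
                           & t in tensor_set setT coradical]
  else coradical.

End CoradicalFiltration.

Arguments coradical {k} C.
Arguments coradical_filtration {k} C n.

Section DualAlgebra.
Context {k : fieldType} (C : coalgType k).

Definition dual : Type := {linear C -> k^o}.
Implicit Types f g : dual.

Definition convolution f g : dual :=
  (tensor_unitl \o tensor_map f g) \o comul.

Definition rational_part_right : set dual :=
  [set f | exists s : seq (dual * C), forall g x,
     convolution f g x = \sum_(p <- s) g p.2 *: p.1 x].

Definition rational_part_left : set dual :=
  [set f | exists s : seq (dual * C), forall g x,
     convolution g f x = \sum_(p <- s) g p.2 *: p.1 x].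

End DualAlgebra.

Arguments dual {k} C.
Arguments rational_part_right {k} C.
Arguments rational_part_left {k} C.

(* Main.v *)
From HB Require Import structures.
Require Import Defs.
From mathcomp Require Import all_boot all_algebra.
From mathcomp Require Import boolp classical_sets.

(** Each functional f acts on C from both sides, through
    [ract f x = sum f(x1) x2] and [lact f x = sum x1 f(x2)], and a convolution
    product f g is g composed with [ract f], or f composed with [lact g].  So f
    lies in the right rational part as soon as [ract f] has finite rank, and in
    the left one as soon as [lact f] has.  A functional of finite rank is built
    in two steps.

    Let J be the annihilator of the coradical C_0 in C*.  A product of m + 1
    elements of J vanishes on C_m, because comul C_m lies in
    C_(m-1) (x) C + C (x) C_0; hence C = C_n forces J^(n+1) = 0
    ([annihilator_power_filtration]).  A non-zero element g of the last non-zero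
    power of J satisfies g J = J g = 0 ([exists_annihilated]), which says that
    [ract g] and [lact g] both take their values in C_0.  Working with powers of
    an ideal, which can be extended on either side, is what treats the two sides
    alike although the definition of the filtration does not.

    It remains to cut C_0 down to finite dimension.  The simple subcoalgebras
    are finite-dimensional ([simple_subcoalgebra_finite]) and independent
    ([simple_disjoint_others]).  Hence a non-zero element y = ract g x of C_0
    stays outside the sum W of all simple subcoalgebras other than D, for some
    simple D ([simple_others_separate]).  A functional e vanishing on W with
    e y = 1 makes [ract e] map C_0 into D, so ract (g e) = ract e o ract g has
    finite rank, while (g e) x = e y = 1.  On the left, e g is used instead. *)

Set Implicit Arguments.
Unset Strict Implicit.
Unset Printing Implicit Defensive.

Import GRing.Theory.

Local Open Scope classical_set_scope.
Local Open Scope ring_scope.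

(* Gives precedence to linear spans of sets over those of sequences. *)
Import Defs.

(** * Subspaces and linear functionals *)

Section Subspaces.
Context {k : fieldType} {M : lmodType k}.
Implicit Types A B : set M.

Lemma subspaceZ A a x : subspace A -> A x -> A (a *: x).
Proof. by case=> A0 AP Ax; rewrite -[_ *: _]addr0; apply: AP. Qed.

Lemma subspaceD A x y : subspace A -> A x -> A y -> A (x + y).
Proof. by case=> _ AP Ax Ay; rewrite -[x]scale1r; apply: AP. Qed.

Lemma subspaceB A x y : subspace A -> A x -> A y -> A (x - y).
Proof. by case=> _ AP Ax Ay; rewrite addrC -scaleN1r; apply: AP. Qed.

Lemma subspace_sum A (I : eqType) (s : seq I) (F : I -> M) :
  subspace A -> (forall i, i \in s -> A (F i)) -> A (\sum_(i <- s) F i).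
Proof.
move=> sA AF; rewrite big_seq; apply: big_ind => //; first by case: sA.
by move=> *; apply: subspaceD.
Qed.

Lemma subspace_setI A B : subspace A -> subspace B -> subspace (A `&` B).
Proof.
move=> [A0 AP] [B0 BP]; split=> // a x y [Ax Bx] [Ay By].
by split; [apply: AP | apply: BP].
Qed.

(** Zorn's lemma for the subspaces that contain A but not x; such a maximal
    subspace is a hyperplane, namely the kernel of the functional below. *)
Lemma maximal_avoiding_subspace A x : subspace A -> ~ A x ->
  exists B, [/\ subspace B, A `<=` B, ~ B x
    & forall E, subspace E -> B `<=` E -> ~ E x -> E `<=` B].
Proof.
move=> sA Ax.
(* The empty set is added because it is the union of the empty chain. *)
pose P B := B = set0 \/ [/\ subspace B, A `<=` B & ~ B x].
have [F FP Ftot|B [PB Bmax]] := @Zorn_bigcup M P.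
  have [[B0 [FB0 [sB0 AB0 _]]]|Fbad] :=
      pselect (exists B, F B /\ [/\ subspace B, A `<=` B & ~ B x]); last first.
    left; apply/seteqP; split=> // y [B FB By].
    by case: (FP B FB) => [B0|?]; [rewrite B0 in By | apply: Fbad; exists B].
  have Fgood B y : F B -> B y -> [/\ subspace B, A `<=` B & ~ B x].
    by move=> FB By; case: (FP B FB) => // B_0; rewrite B_0 in By.
  right; split; last 1 first.
  - by case=> B FB Bx; case: (Fgood B x FB Bx).
  - split=> [|a y z [Y FY Yy] [Z FZ Zz]]; first by exists B0 => //; case: sB0.
    case: (Fgood Y y FY Yy) (Fgood Z z FZ Zz) => [[_ YP] _ _] [[_ ZP] _ _].
    case: (Ftot Y Z FY FZ) => [YZ|ZY].
      by exists Z => //; apply: ZP => //; apply: YZ.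
    by exists Y => //; apply: YP => //; apply: ZY.
  - by move=> y Ay; exists B0 => //; apply: AB0.
have Pmax E : P E -> B `<=` E -> E `<=` B.
  by move=> PE BE; apply: contrapT => EB; apply: (Bmax E) => //; split.
case: PB => [B0|[sB AB Bx]]; last first.
  exists B; split=> // E sE BE Ex; apply: Pmax => //; right; split=> //.
  exact: subset_trans AB BE.
have AB : A `<=` B by apply: (Pmax A); [right; split | rewrite B0].
by have := AB 0 (proj1 sA); rewrite B0.
Qed.

(** For B maximal among the subspaces containing A and avoiding x, the space
    spanned by B and x is everything: if y is outside B then x lies in B + k y.
    The functional reads off the coefficient of x. *)
Lemma separating_functional A x : subspace A -> ~ A x ->
  exists2 f : {linear M -> k^o}, (forall y, A y -> f y = 0) & f x = 1.
Proof.
move=> sA Ax; have [B [sB AB Bx Bmax]] := maximal_avoiding_subspace sA Ax.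
have [B0 BP] := sB.
have coord y : exists c : k, B (y - c *: x).
  have [By|By] := pselect (B y); first by exists 0; rewrite scale0r subr0.
  pose E := [set z | exists a : k, B (z + a *: y)].
  have sE : subspace E.
    split; first by exists 0; rewrite scale0r addr0.
    move=> a z w [b Bz] [c Bw]; exists (a * b + c).
    by rewrite scalerDl -scalerA addrACA -scalerDr; apply: BP.
  have BE : B `<=` E by move=> z Bz; exists 0; rewrite scale0r addr0.
  have Ey : E y by exists (-1); rewrite scaleN1r subrr.
  have [[a Bxa]|Ex] := pselect (E x); last by case: By; exact: (Bmax E).
  have a0 : a != 0.
    by apply/eqP => a0; apply: Bx; rewrite a0 scale0r addr0 in Bxa.
  exists (- a^-1); rewrite -[y]scale1r -(mulVf a0) -scalerA.
  by rewrite scaleNr opprK -scalerDr addrC; apply: subspaceZ.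
have coord_uniq y b c : B (y - b *: x) -> B (y - c *: x) -> b = c.
  move=> yb yc; apply/eqP; rewrite -subr_eq0; apply/negP => /negP bc.
  have := subspaceB sB yc yb.
  rewrite opprD opprK addrACA subrr add0r addrC -scalerBl => Bbc.
  by apply: Bx; rewrite -[x]scale1r -(mulVf bc) -scalerA; apply: subspaceZ.
have [f fP] := choice coord.
have f_linear : linear (f : M -> k^o).
  move=> a y z; apply: (@coord_uniq (a *: y + z)) => //.
  rewrite scalerDl -scalerA opprD addrACA -scalerBr.
  exact: BP.
pose F : {linear M -> k^o} :=
  HB.pack (f : M -> k^o) (GRing.isLinear.Build k M k^o *:%R f f_linear).
exists F => [y Ay|] /=.
  by apply: (@coord_uniq y) => //; rewrite scale0r subr0; apply: AB.
by apply: (@coord_uniq x) => //; rewrite scale1r subrr.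
Qed.

Lemma functionals_separate (x y : M) :
  (forall f : {linear M -> k^o}, f x = f y) -> x = y.
Proof.
move=> fxy; apply/eqP; rewrite -subr_eq0; apply/negP => /negP/eqP xy.
have s0 : subspace [set 0 : M].
  by split=> // a _ _ -> ->; rewrite scaler0 addr0.
have [f _] := separating_functional s0 xy.
by rewrite linearB fxy subrr => /esym/eqP; rewrite oner_eq0.
Qed.

(** A finite-dimensional space has a basis whose coordinate functions extend
    to the whole space M.  When a new vector c enlarges the span, the old
    coordinates phi d are corrected by a functional f that vanishes on the old
    span and takes the value 1 at c. *)
Lemma finite_coordinates (l : seq M) :
  exists (b : seq M) (phi : M -> {linear M -> k^o}), {subset b <= l} /\
    forall y, span [set` l] y -> y = \sum_(c <- b) phi c y *: c.
Proof.
elim: l => [|c l [b [phi [bl bE]]]].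
  exists [::], (fun=> \0%R); split=> // y; rewrite big_nil set_nil.
  apply: (span_min (B := [set 0])) => //.
  by split=> // a _ _ -> ->; rewrite scaler0 addr0.
have cl_min B : subspace B -> B c -> span [set` l] `<=` B ->
    span [set` c :: l] `<=` B.
  move=> sB Bc lB; apply: span_min => // x /=; rewrite inE => /orP[/eqP->//|xl].
  by apply: lB; apply: sub_span.
have [lc|lc] := pselect (span [set` l] c).
  exists b, phi; split=> [x /bl|y cly]; first by rewrite inE orbC => ->.
  by apply: bE; apply: cl_min cly => //; apply: subspace_span.
have [f fl fc] := separating_functional (subspace_span _) lc.
pose psi d : {linear M -> k^o} := phi d \- (phi d c \*: f).
exists (c :: b), (fun d => if d == c then f else psi d).
split=> [d|y cly]; first by rewrite !inE => /orP[-> // | /bl ->]; rewrite orbT.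
have lfy : span [set` l] (y - f y *: c).
  have sl := subspace_span [set` l].
  apply: (cl_min [set z | span [set` l] (z - f z *: c)]) cly => [||z lz] /=.
  - split=> /= [|a z w lz lw]; first by rewrite linear0 scale0r subr0; case: sl.
    rewrite linearP scalerDl -scalerA opprD addrACA -scalerBr.
    exact: (proj2 sl).
  - by rewrite fc scale1r subrr; case: sl.
  - by rewrite (fl z lz) scale0r subr0.
rewrite big_cons eqxx -[LHS](subrK (f y *: c)) addrC [X in _ + X](bE _ lfy).
congr (_ + _); apply: eq_big_seq => d db.
have /negbTE -> : d != c.
  by apply/eqP => dc; apply: lc; apply: sub_span; rewrite /= -dc; apply: bl.
rewrite linearB linearZ /=.
by congr (_ *: _); congr (_ - _); apply: mulrC.
Qed.

End Subspaces.

(** * Contracting one factor of a tensor *)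

Section Contraction.
Context {k : fieldType} {V : lmodType k}.
Implicit Types (f : {linear V -> k^o}) (D : set V) (t : tensor V V).

Definition contractl f : {linear tensor V V -> V} :=
  tensor_unitl \o tensor_map f idfun.

Definition contractr f : {linear tensor V V -> V} :=
  tensor_unitr \o tensor_map idfun f.

Lemma contractlE f a b : contractl f (a \ot b) = f a *: b.
Proof. by rewrite /contractl /= tensor_mapE tensor_unitlE. Qed.

Lemma contractrE f a b : contractr f (a \ot b) = f b *: a.
Proof. by rewrite /contractr /= tensor_mapE tensor_unitrE. Qed.

(** Expanding the left factors in coordinates makes the right factors
    contractions of t itself, whatever the initial expression of t was. *)
Lemma tensor_coordinatesl (s : seq (V * V)) t :
  t = \sum_(p <- s) p.1 \ot p.2 ->
  exists b (phi : V -> {linear V -> k^o}),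
    {subset b <= [seq p.1 | p <- s]} /\
    t = \sum_(c <- b) c \ot contractl (phi c) t.
Proof.
move=> tE; have [b [phi [bs bE]]] := finite_coordinates [seq p.1 | p <- s].
exists b, phi; split=> //; rewrite {1}tE.
transitivity (\sum_(p <- s) \sum_(c <- b) c \ot (phi c p.1 *: p.2)).
  apply: eq_big_seq => p ps.
  rewrite {1}(bE p.1); last by apply: sub_span; apply: map_f.
  rewrite linear_sumlz; apply: eq_bigr => c _.
  by rewrite linearZl_LR linearZr_LR.
rewrite exchange_big; apply: eq_bigr => c _.
have -> : contractl (phi c) t = \sum_(p <- s) phi c p.1 *: p.2.
  by rewrite tE linear_sum; apply: eq_bigr => p _; rewrite contractlE.
by rewrite linear_sumr.
Qed.

Lemma tensor_coordinatesr (s : seq (V * V)) t :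
  t = \sum_(p <- s) p.1 \ot p.2 ->
  exists b (phi : V -> {linear V -> k^o}),
    {subset b <= [seq p.2 | p <- s]} /\
    t = \sum_(c <- b) contractr (phi c) t \ot c.
Proof.
move=> tE; have [b [phi [bs bE]]] := finite_coordinates [seq p.2 | p <- s].
exists b, phi; split=> //; rewrite {1}tE.
transitivity
  (\sum_(p <- s) \sum_(c <- b) (phi c p.2 *: p.1 : V) \ot c).
  apply: eq_big_seq => p ps.
  rewrite {1}(bE p.2); last by apply: sub_span; apply: map_f.
  rewrite linear_sumr; apply: eq_bigr => c _.
  by rewrite linearZl_LR linearZr_LR.
rewrite exchange_big; apply: eq_bigr => c _.
have -> : contractr (phi c) t = \sum_(p <- s) phi c p.2 *: p.1.
  by rewrite tE linear_sum; apply: eq_bigr => p _; rewrite contractrE.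
by rewrite linear_sumlz.
Qed.

(** This is the equality of D (x) D with the intersection of D (x) V and
    V (x) D, for subspaces defined by contractions.  A first expansion brings
    the right factors into D; the second one takes its basis among these
    factors, and its left factors are again contractions of t. *)
Lemma tensor_set_contract D t :
  (forall f, D (contractl f t)) -> (forall f, D (contractr f t)) ->
  tensor_set D D t.
Proof.
move=> Dl Dr; have [s /tensor_coordinatesl[b [phi [_ tE]]]] := tensor_sum t.
have {}tE : t = \sum_(p <- [seq (c, contractl (phi c) t) | c <- b]) p.1 \ot p.2.
  by rewrite big_map.
have [b' [psi [b'b {}tE]]] := tensor_coordinatesr tE.
rewrite {}[X in tensor_set _ _ X]tE; apply: subspace_sum => [|c cb'].
  exact: subspace_span.
apply: sub_span; exists (contractr (psi c) t) => //; exists c => //.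
have := b'b c cb'.
rewrite -map_comp => /mapP[d _ ->].
exact: Dl.
Qed.

End Contraction.

(** * The two actions of the dual algebra *)

Section Actions.
Context {k : fieldType} {C : coalgType k}.
Implicit Types (f g h : dual C) (x y : C) (D E : set C).

Definition ract f : {linear C -> C} :=
  contractl f \o comul.

Definition lact f : {linear C -> C} :=
  contractr f \o comul.

Lemma convolution_ract f g x : convolution f g x = g (ract f x).
Proof.
rewrite /convolution /ract /=; have [s ->] := tensor_sum (comul x).
rewrite !linear_sum; apply: eq_bigr => p _.
by rewrite !tensor_mapE !tensor_unitlE linearZ.
Qed.

Lemma convolution_lact f g x : convolution f g x = f (lact g x).
Proof.
rewrite /convolution /lact /=; have [s ->] := tensor_sum (comul x).
rewrite !linear_sum; apply: eq_bigr => p _.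
rewrite !tensor_mapE tensor_unitlE tensor_unitrE linearZ.
exact: mulrC.
Qed.

(** Both sides evaluate f (x) (g (x) h) on an iterated comultiplication of x,
    the two iterations being identified by coassociativity. *)
Lemma convolutionA f g h x :
  convolution (convolution f g) h x = convolution f (convolution g h) x.
Proof.
pose ev : {linear tensor C (tensor C C) -> k^o} :=
  tensor_unitl \o tensor_map f (tensor_unitl \o tensor_map g h).
transitivity (ev (tensor_assoc (tensor_map comul idfun (comul x)))).
  rewrite /convolution /=; have [s ->] := tensor_sum (comul x).
  rewrite !linear_sum; apply: eq_bigr => p _.
  rewrite !tensor_mapE tensor_unitlE /=; have [t ->] := tensor_sum (comul p.1).
  rewrite 2!linear_sum scaler_suml.
  have -> : (\sum_(q <- t) tens q.1 q.2) \ot p.2 =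
      \sum_(q <- t) tens (tens q.1 q.2) p.2 by exact: linear_sumlz.
  rewrite !linear_sum; apply: eq_bigr => q _.
  rewrite tensor_assocE !tensor_mapE !tensor_unitlE /= !tensor_mapE.
  by rewrite tensor_unitlE scalerA.
rewrite comulA /convolution /=; have [s ->] := tensor_sum (comul x).
rewrite !linear_sum; apply: eq_bigr => p _.
by rewrite !tensor_mapE !tensor_unitlE /=.
Qed.

Lemma convolution1l f x : convolution counit f x = f x.
Proof. by rewrite convolution_ract /ract /= counitl. Qed.

Lemma convolution1r f x : convolution f counit x = f x.
Proof. by rewrite convolution_lact /lact /= counitr. Qed.

(** The action laws hold because functionals separate points: applying an
    arbitrary functional h turns each of them into associativity of a triple
    convolution product. *)
Lemma ract_convolution f g x : ract (convolution f g) x = ract g (ract f x).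
Proof.
apply: functionals_separate => h.
rewrite -[LHS]convolution_ract convolutionA convolution_ract.
exact: convolution_ract.
Qed.

Lemma lact_convolution f g x : lact (convolution f g) x = lact f (lact g x).
Proof.
apply: functionals_separate => h.
rewrite -[LHS]convolution_lact -convolutionA convolution_lact.
exact: convolution_lact.
Qed.

Lemma lact_ract f g x : lact f (ract g x) = ract g (lact f x).
Proof.
apply: functionals_separate => h.
rewrite -[LHS](convolution_lact h f) -convolution_ract -convolutionA.
by rewrite convolution_lact convolution_ract.
Qed.

Lemma subcoalgebra_ract D f x : subcoalgebra D -> D x -> D (ract f x).
Proof.
move=> [sD DD] Dx; rewrite /ract /=.
apply: (span_min (B := [set t | D (tensor_unitl (tensor_map f idfun t))])
  _ _ (DD x Dx)) => [|_ [a Da [b Db <-]]] /=.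
  split=> /= [|a s t Ds Dt]; first by rewrite !linear0; case: sD.
  by rewrite !linearP; apply: (proj2 sD).
by rewrite tensor_mapE tensor_unitlE; apply: subspaceZ.
Qed.

Lemma subcoalgebra_lact D f x : subcoalgebra D -> D x -> D (lact f x).
Proof.
move=> [sD DD] Dx; rewrite /lact /=.
apply: (span_min (B := [set t | D (tensor_unitr (tensor_map idfun f t))])
  _ _ (DD x Dx)) => [|_ [a Da [b Db <-]]] /=.
  split=> /= [|a s t Ds Dt]; first by rewrite !linear0; case: sD.
  by rewrite !linearP; apply: (proj2 sD).
by rewrite tensor_mapE tensor_unitrE; apply: subspaceZ.
Qed.

(** Together with [subcoalgebra_ract] and [subcoalgebra_lact], this identifies
    subcoalgebras with sub-bimodules over C*, so that nothing below has to
    manipulate tensors in order to recognize a subcoalgebra. *)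
Lemma stable_subcoalgebra D : subspace D ->
  (forall f x, D x -> D (ract f x)) -> (forall f x, D x -> D (lact f x)) ->
  subcoalgebra D.
Proof.
move=> sD Dr Dl; split=> // x Dx.
by apply: tensor_set_contract => f; [apply: Dr | apply: Dl].
Qed.

Lemma subcoalgebra_setI D E :
  subcoalgebra D -> subcoalgebra E -> subcoalgebra (D `&` E).
Proof.
move=> sD sE; apply: stable_subcoalgebra.
- by apply: subspace_setI; [case: sD | case: sE].
- by move=> f x [Dx Ex]; split; apply: subcoalgebra_ract.
- by move=> f x [Dx Ex]; split; apply: subcoalgebra_lact.
Qed.

Lemma subcoalgebra_span (A : set C) :
  (forall f x, A x -> span A (ract f x)) ->
  (forall f x, A x -> span A (lact f x)) -> subcoalgebra (span A).
Proof.
have sA := subspace_span A.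
move=> Ar Al; apply: stable_subcoalgebra => // f.
- apply: (span_min (B := [set x | span A (ract f x)])); last exact: Ar.
  split=> [|a x y Ax Ay] /=; first by rewrite !linear0; case: sA.
  by rewrite !linearP; apply: (proj2 sA).
- apply: (span_min (B := [set x | span A (lact f x)])); last exact: Al.
  split=> [|a x y Ax Ay] /=; first by rewrite !linear0; case: sA.
  by rewrite !linearP; apply: (proj2 sA).
Qed.

(** A functional h takes on [ract f x] the value (f h) x = f (lact h x), and
    [lact h x] is still in D. *)
Lemma ract_vanish D f x :
  subcoalgebra D -> (forall y, D y -> f y = 0) -> D x -> ract f x = 0.
Proof.
move=> sD fD Dx; apply: functionals_separate => h.
rewrite -[LHS](convolution_ract f h) convolution_lact fD ?linear0 //.
exact: subcoalgebra_lact.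
Qed.

Lemma lact_vanish D f x :
  subcoalgebra D -> (forall y, D y -> f y = 0) -> D x -> lact f x = 0.
Proof.
move=> sD fD Dx; apply: functionals_separate => h.
rewrite -[LHS](convolution_lact h f) convolution_ract fD ?linear0 //.
exact: subcoalgebra_ract.
Qed.

(** * Finite dimension and independence of simple subcoalgebras *)

(** The bimodule generated by x is spanned by the left factors of the
    comultiplications of the right factors of [comul x], and these are finitely
    many. *)
Lemma finite_bimodule x :
  exists l : seq C, forall f g, span [set` l] (lact g (ract f x)).
Proof.
have [s xE] := tensor_sum (comul x).
have [r rE] := choice (fun y : C => tensor_sum (comul y)).
exists [seq q.1 | p <- s, q <- r p.2] => f g.
have sl := subspace_span [set` [seq q.1 | p <- s, q <- r p.2]].
have -> : ract f x = \sum_(p <- s) f p.1 *: p.2.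
  rewrite -[LHS]/(contractl f (comul x)) xE linear_sum.
  by apply: eq_bigr => p _; rewrite contractlE.
rewrite linear_sum; apply: subspace_sum => // p ps.
rewrite linearZ; apply: subspaceZ => //.
have -> : lact g p.2 = \sum_(q <- r p.2) g q.2 *: q.1.
  rewrite -[LHS]/(contractr g (comul p.2)) {1}rE linear_sum.
  by apply: eq_bigr => q _; rewrite contractrE.
apply: subspace_sum => // q qr; apply: subspaceZ => //; apply: sub_span => /=.
by apply/allpairsPdep; exists p, q.
Qed.

(** A simple subcoalgebra is generated by any of its non-zero elements. *)
Lemma simple_subcoalgebra_finite D : simple_subcoalgebra D ->
  exists l : seq C, D `<=` span [set` l].
Proof.
move=> [sD D0 Dmin].
have [x [Dx x0]] : exists x, D x /\ x <> 0.
  apply: contrapT => Dx; apply: D0; apply/seteqP; split=> [x Dx'|_ ->] /=.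
    by apply: contrapT => x0; apply: Dx; exists x.
  by case: sD => -[].
pose A := [set y | exists f g, y = lact g (ract f x)].
have sA : subcoalgebra (span A).
  apply: subcoalgebra_span => h _ [f [g ->]]; apply: sub_span.
    by exists (convolution f h), g; rewrite ract_convolution -lact_ract.
  by exists f, (convolution h g); rewrite lact_convolution.
have Ax : span A x.
  apply: sub_span; exists counit, counit.
  by rewrite /lact /ract /= /contractl /contractr /= counitl counitr.
have AD : span A `<=` D.
  apply: span_min; first by case: sD.
  by move=> _ [f [g ->]]; apply: subcoalgebra_lact => //; apply: subcoalgebra_ract.
have [l lx] := finite_bimodule x; exists l.
have <- : span A = D.
  by case: (Dmin _ sA AD) => // A0; case: x0; rewrite A0 in Ax.
by apply: span_min; [exact: subspace_span | move=> _ [f [g ->]]].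
Qed.

Definition sum_sets (P : set (set C)) : set C := span (\bigcup_(D in P) D).

Lemma sum_sets_sub (P Q : set (set C)) : P `<=` Q -> sum_sets P `<=` sum_sets Q.
Proof.
move=> PQ; apply: span_min; first exact: subspace_span.
by move=> x [D PD Dx]; apply: sub_span; exists D => //; apply: PQ.
Qed.

Lemma subcoalgebra_sum_sets (P : set (set C)) :
  P `<=` @subcoalgebra _ C -> subcoalgebra (sum_sets P).
Proof.
move=> Psub; apply: subcoalgebra_span => f x [D PD Dx]; apply: sub_span.
  by exists D => //; apply: subcoalgebra_ract => //; apply: Psub.
by exists D => //; apply: subcoalgebra_lact => //; apply: Psub.
Qed.

Lemma sum_sets0 x : sum_sets set0 x -> x = 0.
Proof.
apply: (span_min (B := [set 0])) => [|y [D []]].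
by split=> // a _ _ -> ->; rewrite scaler0 addr0.
Qed.

Lemma sum_sets_cons D (l : seq (set C)) x : subspace D ->
  sum_sets [set` D :: l] x ->
  exists2 d, D d & exists2 y, sum_sets [set` l] y & x = d + y.
Proof.
move=> sD; set S := sum_sets [set` l]; have sS : subspace S := subspace_span _.
apply: (span_min (B := [set x | exists2 d, D d & exists2 y, S y & x = d + y])).
  split=> [|a _ _ [d Dd [y Sy ->]] [e De [z Sz ->]]] /=.
    by exists 0; [case: sD | exists 0; rewrite ?addr0 //; case: sS].
  exists (a *: d + e); first exact: (proj2 sD).
  exists (a *: y + z); first exact: (proj2 sS).
  by rewrite scalerDr addrACA.
move=> y [E /=]; rewrite inE => /orP[/eqP-> Dy|El Ey].
  by exists y => //; exists 0; rewrite ?addr0 //; case: sS.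
exists 0; first by case: sD.
by exists y; rewrite ?add0r //; apply: sub_span; exists E.
Qed.

Lemma sum_sets_finite (P : set (set C)) x : sum_sets P x ->
  exists2 l : seq (set C), [set` l] `<=` P & sum_sets [set` l] x.
Proof.
move=> [s sP ->]; elim: s sP => [|p s IHs] sP.
  exists [::]; first by rewrite set_nil.
  by rewrite big_nil; case: (subspace_span (\bigcup_(D in [set` [::]]) (D : set C))).
have [|l lP ls] := IHs; first by move=> q qs; apply: sP; rewrite inE qs orbT.
have [D PD Dp] : (\bigcup_(D in P) D) p.2 by apply: sP; rewrite inE eqxx.
exists (D :: l) => [E /=|]; first by rewrite inE => /orP[/eqP->|/lP].
rewrite big_cons; apply: (proj2 (subspace_span _)).
  by apply: sub_span; exists D => //=; rewrite inE eqxx.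
by apply: sum_sets_sub ls => E /= El; rewrite inE El orbT.
Qed.

(** By induction on the number of summands.  If x = e + y with e in the first
    summand E and x is non-zero, then x is not in E, since D and E are distinct
    and simple.  For f vanishing on E with f x = 1, [ract f x] = [ract f y] lies
    both in D and in the sum of the other summands, hence is zero by induction;
    but its counit is f x. *)
Lemma simple_disjoint_finite D (l : seq (set C)) x :
  simple_subcoalgebra D -> [set` l] `<=` @simple_subcoalgebra _ C -> D \notin l ->
  D x -> sum_sets [set` l] x -> x = 0.
Proof.
move=> [sD D0 Dmin]; elim: l x => [|E l IHl] x lsimple Dl Dx.
  by rewrite set_nil; apply: sum_sets0.
have [sE _ Emin] : simple_subcoalgebra E by apply: lsimple; rewrite /= inE eqxx.
have {}lsimple : [set` l] `<=` @simple_subcoalgebra _ C.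
  by move=> S Sl; apply: lsimple; rewrite /= inE Sl orbT.
move: Dl; rewrite inE negb_or => /andP[/eqP DE Dl].
move=> /(sum_sets_cons (proj1 sE))[e Ee [y ly xE]].
apply: contrapT => x0.
have sDE := subcoalgebra_setI sD sE.
have Ex : ~ E x.
  move=> Ex; have nDE : D `&` E <> [set 0].
    by move=> /seteqP[/(_ x) /= DE0 _]; apply/x0/DE0.
  case: (Dmin _ sDE (@subIsetl _ _ _)) => // DED.
  by case: (Emin _ sDE (@subIsetr _ _ _)) => // DEE; apply: DE; rewrite -DED.
have [f fE fx] := separating_functional (proj1 sE) Ex.
have fxy : ract f x = ract f y by rewrite xE linearD (ract_vanish sE fE Ee) add0r.
have fx0 : ract f x = 0.
  apply: IHl => //; first exact: subcoalgebra_ract.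
  rewrite fxy; apply: subcoalgebra_ract => //; apply: subcoalgebra_sum_sets.
  by move=> S /lsimple[].
have := convolution1r f x; rewrite convolution_ract fx0 linear0 fx => /esym/eqP.
by rewrite oner_eq0.
Qed.

Definition simple_others D : set (set C) :=
  [set E | simple_subcoalgebra E /\ E <> D].

Lemma simple_disjoint_others D x :
  simple_subcoalgebra D -> D x -> sum_sets (simple_others D) x -> x = 0.
Proof.
move=> simpleD Dx /sum_sets_finite[l lP lx].
apply: (simple_disjoint_finite simpleD _ _ Dx lx) => [E /lP[] // |].
by apply/negP => /lP[_]; apply.
Qed.

(** Write x as a sum over a finite list of simple subcoalgebras.  If x belongs
    to every sum of others, then its component d in the first D of the list also
    lies in the sum of the others, because the remaining terms do; so d = 0 by
    independence, and the list can be shortened. *)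
Lemma simple_others_separate x : coradical C x -> x <> 0 ->
  exists2 D, simple_subcoalgebra D & ~ sum_sets (simple_others D) x.
Proof.
move=> /sum_sets_finite[l lsimple lx] x0; apply: contrapT => noD.
have {noD}others D : simple_subcoalgebra D -> sum_sets (simple_others D) x.
  by move=> sD; apply: contrapT => Dx; apply: noD; exists D.
apply: x0; elim: l lsimple lx => [|D l IHl] lsimple.
  by rewrite set_nil; apply: sum_sets0.
have simpleD : simple_subcoalgebra D by apply: lsimple; rewrite /= inE eqxx.
have {}lsimple : [set` l] `<=` @simple_subcoalgebra _ C.
  by move=> S Sl; apply: lsimple; rewrite /= inE Sl orbT.
have [Dl|Dl] := boolP (D \in l).
  move=> lx; apply: IHl => //; apply: sum_sets_sub lx => E /=.
  by rewrite inE => /orP[/eqP->|].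
case: (simpleD) => -[sD _] _ _ /(sum_sets_cons sD)[d Dd [y ly xE]].
apply: IHl => //; suff d0 : d = 0 by rewrite xE d0 add0r.
apply: (simple_disjoint_others simpleD Dd).
rewrite -[d](addrK y) -xE; apply: subspaceB; first exact: subspace_span.
  exact: others.
apply: sum_sets_sub ly => E /= El; split; first exact: lsimple.
by move=> ED; rewrite -ED El in Dl.
Qed.

(** * Powers of the annihilator of the coradical *)

Definition coradical_annihilator : set (dual C) :=
  [set f | forall x, coradical C x -> f x = 0].

(** The products of m elements of the annihilator, rather than their span.
    They are taken up to pointwise equality because functionals are bundled with
    their linearity proofs. *)
Fixpoint annihilator_power m : set (dual C) :=
  if m is m'.+1 then
    [set f | exists g h, [/\ annihilator_power m' g, coradical_annihilator h
                           & forall x, f x = convolution g h x]]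
  else [set f | forall x, f x = counit x].

Lemma annihilator_powerSP m f : annihilator_power m.+1 f ->
  exists g h, [/\ annihilator_power m g, coradical_annihilator h
                 & forall x, f x = convolution g h x].
Proof. by []. Qed.

Lemma annihilator_powerS m f h :
  annihilator_power m f -> coradical_annihilator h ->
  annihilator_power m.+1 (convolution f h).
Proof. by exists f, h. Qed.

Lemma annihilator_power_ext m f g :
  (forall x, f x = g x) -> annihilator_power m f -> annihilator_power m g.
Proof.
case: m => [|m] fg.
  by move=> f1 x; rewrite -fg; apply: f1.
move=> [h [h' [hm Jh' fE]]]; exists h, h'; split=> // x.
by rewrite -fg; apply: fE.
Qed.

(** [annihilator_power] grows on the right by definition; associativity lets it
    grow on the left as well, which the left-hand statement relies on. *)
Lemma annihilator_power_consl m f h :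
  coradical_annihilator h -> annihilator_power m f ->
  annihilator_power m.+1 (convolution h f).
Proof.
move=> Jh; elim: m f => [f f1|m IHm f /annihilator_powerSP[g [h' [gm Jh' fE]]]].
  apply: (@annihilator_power_ext _ (convolution counit h)) => [x|].
    rewrite convolution1l convolution_ract [RHS]f1.
    by rewrite -convolution_ract convolution1r.
  exact: annihilator_powerS.
apply: (@annihilator_power_ext _ (convolution (convolution h g) h')) => [x|].
  by rewrite convolutionA convolution_ract [RHS]convolution_ract fE.
by apply: annihilator_powerS => //; apply: IHm.
Qed.

(** In f = g h with g a product of m factors, g kills C_(m-1) and h kills C_0,
    so g (x) h kills C_(m-1) (x) C + C (x) C_0, which contains the
    comultiplication of C_m. *)
Lemma annihilator_power_filtration m f x :
  annihilator_power m.+1 f -> coradical_filtration C m x -> f x = 0.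
Proof.
elim: m f x => [|m IHm] f x /annihilator_powerSP[g [h [gm Jh ->]]].
  move=> Cx; rewrite convolution_lact [LHS]gm -convolution_lact convolution1l.
  exact: Jh.
move=> [s sC [t tC xE]]; rewrite /convolution /= -xE !linearD.
have sub0 : subspace [set u : tensor C C | tensor_unitl (tensor_map g h u) = 0].
  split=> /= [|a u v u0 v0]; first by rewrite !linear0.
  by rewrite !linearP /= u0 v0 scaler0 addr0.
have s0 : tensor_unitl (tensor_map g h s) = 0.
  apply: (span_min sub0 _ sC) => _ [a Ca [b _ <-]] /=.
  by rewrite tensor_mapE tensor_unitlE (IHm g a) ?scale0r.
have t0 : tensor_unitl (tensor_map g h t) = 0.
  apply: (span_min sub0 _ tC) => _ [a _ [b Cb <-]] /=.
  by rewrite tensor_mapE tensor_unitlE Jh ?scaler0.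
by rewrite [X in X + _]s0 [X in _ + X]t0 addr0.
Qed.

(** Going down from the exponent n + 1, where all products vanish, one meets a
    first non-zero product g before reaching exponent 0, whose only element
    is the counit, non-zero as C is. *)
Lemma exists_annihilated n : (exists x : C, x != 0) ->
  coradical_filtration C n = [set: C] ->
  exists2 g : dual C, exists x, g x != 0
    & forall h, coradical_annihilator h ->
        (forall x, convolution g h x = 0) /\ (forall x, convolution h g x = 0).
Proof.
move=> [z z0] Cn.
have : forall f, annihilator_power n.+1 f -> forall x, f x = 0.
  by move=> f fn x; apply: (annihilator_power_filtration fn); rewrite Cn.
elim: {Cn}n.+1 => [|m IHm] Jm.
  case/eqP: z0; apply: functionals_separate => h.
  rewrite linear0 -[LHS](convolution1l h) convolution_lact.
  exact: (Jm (counit : dual C)).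
have [Jm0|] := pselect (forall f, annihilator_power m f -> forall x, f x = 0).
  exact: IHm.
move=> /existsNP[g /not_implyP[gm /existsNP[x /eqP gx]]].
exists g; first by exists x.
move=> h Jh; split=> y.
  by apply: (Jm (convolution g h)); apply: annihilator_powerS.
by apply: (Jm (convolution h g)); apply: annihilator_power_consl.
Qed.

(** * Finite rank and rationality *)

Lemma annihilator_coradical x :
  (forall h, coradical_annihilator h -> h x = 0) -> coradical C x.
Proof.
move=> hx; apply: contrapT => Cx.
have [h Jh h1] := separating_functional (subspace_span _) Cx.
by have /eqP := hx h Jh; rewrite h1 oner_eq0.
Qed.

(** The coradical is the sum of D, which [ract e] preserves, and of the other
    simple subcoalgebras, which it kills since e does. *)
Lemma ract_simple_others D (e : dual C) x : simple_subcoalgebra D ->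
  (forall y, sum_sets (simple_others D) y -> e y = 0) ->
  coradical C x -> D (ract e x).
Proof.
move=> simpleD eD; have [sD _ _] := simpleD; have [[D0 DP] _] := sD.
apply: (span_min (B := [set x | D (ract e x)])) => [|y [E simpleE Ey]].
  by split=> [|a y z Dy Dz] /=; rewrite ?linear0 // !linearP; apply: DP.
have [ED|ED] := pselect (E = D).
  by rewrite /=; apply: subcoalgebra_ract => //; rewrite -ED.
suff e0 : ract e y = 0 by rewrite -e0 in D0.
apply: (@ract_vanish E) => //; first by case: simpleE.
by move=> z Ez; apply: eD; apply: sub_span; exists E.
Qed.

Lemma lact_simple_others D (e : dual C) x : simple_subcoalgebra D ->
  (forall y, sum_sets (simple_others D) y -> e y = 0) ->
  coradical C x -> D (lact e x).
Proof.
move=> simpleD eD; have [sD _ _] := simpleD; have [[D0 DP] _] := sD.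
apply: (span_min (B := [set x | D (lact e x)])) => [|y [E simpleE Ey]].
  by split=> [|a y z Dy Dz] /=; rewrite ?linear0 // !linearP; apply: DP.
have [ED|ED] := pselect (E = D).
  by rewrite /=; apply: subcoalgebra_lact => //; rewrite -ED.
suff e0 : lact e y = 0 by rewrite -e0 in D0.
apply: (@lact_vanish E) => //; first by case: simpleE.
by move=> z Ez; apply: eD; apply: sub_span; exists E.
Qed.

(** In coordinates on the span of l, the identity (f g) x = g (ract f x)
    becomes an expression of f g by finitely many functionals. *)
Lemma rational_part_right_finite f (l : seq C) :
  (forall x, span [set` l] (ract f x)) -> rational_part_right C f.
Proof.
move=> fl; have [b [phi [_ bE]]] := finite_coordinates l.
exists [seq ((phi c \o ract f : {linear C -> k^o}) : dual C, c) | c <- b] => g x.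
rewrite big_map convolution_ract (bE _ (fl x)) linear_sum.
by apply: eq_bigr => c _; rewrite linearZ; apply: mulrC.
Qed.

Lemma rational_part_left_finite f (l : seq C) :
  (forall x, span [set` l] (lact f x)) -> rational_part_left C f.
Proof.
move=> fl; have [b [phi [_ bE]]] := finite_coordinates l.
exists [seq ((phi c \o lact f : {linear C -> k^o}) : dual C, c) | c <- b] => g x.
rewrite big_map convolution_lact (bE _ (fl x)) linear_sum.
by apply: eq_bigr => c _; rewrite linearZ; apply: mulrC.
Qed.

End Actions.

Theorem theorem1p2 (k : fieldType) (C : coalgType k) (n : nat)
    (C_neq0 : exists x : C, x != 0)
    (C_eq : coradical_filtration C n = [set: C]) :
  (exists2 f : dual C, rational_part_right C f & exists x : C, f x != 0) /\
  (exists2 f : dual C, rational_part_left C f & exists x : C, f x != 0).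
Proof.
have [g [x gx] gJ] := exists_annihilated C_neq0 C_eq.
have gr y : coradical C (ract g y).
  apply: annihilator_coradical => h /gJ[gh _].
  by rewrite -convolution_ract.
have gl y : coradical C (lact g y).
  apply: annihilator_coradical => h /gJ[_ hg].
  by rewrite -convolution_lact.
split.
- have gx0 : ract g x <> 0.
    move=> gx0; move: gx; rewrite -[g x]convolution1r convolution_ract gx0.
    by rewrite linear0 eqxx.
  have [D simpleD Dgx] := simple_others_separate (gr x) gx0.
  have [e eD egx] := separating_functional (subspace_span _) Dgx.
  have [l Dl] := simple_subcoalgebra_finite simpleD.
  exists (convolution g e); last first.
    by exists x; rewrite convolution_ract egx oner_eq0.
  apply: (@rational_part_right_finite _ _ _ l) => y.
  by rewrite ract_convolution; apply: Dl; apply: ract_simple_others.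
- have gx0 : lact g x <> 0.
    move=> gx0; move: gx; rewrite -[g x]convolution1l convolution_lact gx0.
    by rewrite linear0 eqxx.
  have [D simpleD Dgx] := simple_others_separate (gl x) gx0.
  have [e eD egx] := separating_functional (subspace_span _) Dgx.
  have [l Dl] := simple_subcoalgebra_finite simpleD.
  exists (convolution e g); last first.
    by exists x; rewrite convolution_lact egx oner_eq0.
  apply: (@rational_part_left_finite _ _ _ l) => y.
  by rewrite lact_convolution; apply: Dl; apply: lact_simple_others.
Qed.
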